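(* Let $\gamma$ be a composition of $n$. For any composition $\alpha\le\gamma$ of $n$, let $\zeta$ be the composition of $n$ with descent set $D(\zeta)=(D(\gamma^c)\setminus D(\alpha))\cup D(\gamma)$. Then $$\omega^{c}\left(\mathbf{R}^{(\gamma)}_\alpha(A;t)\right)=t^{n(\gamma)}\,\mathbf{R}^{(\gamma)}_\zeta\left(A;\frac1t\right).$$
   Context: A composition $\alpha=(\alpha_1,\ldots,\alpha_{l(\alpha)})$ of $n$ is a sequence of positive integers with sum $n$; $l(\alpha)$ is its length. Its descent set is $D(\alpha)=\{\alpha_1,\alpha_1+\alpha_2,\ldots,\alpha_1+\cdots+\alpha_{l(\alpha)-1}\}\subseteq\{1,\ldots,n-1\}$; this gives a bijection between compositions of $n$ and subsets of $\{1,\ldots,n-1\}$. Refinement order on compositions of $n$: $\alpha\le\beta$ iff $D(\beta)\subseteq D(\alpha)$. The complement $\alpha^c$ is the composition of $n$ with $D(\alpha^c)=\{1,\ldots,n-1\}\setminus D(\alpha)$. For compositions $\alpha,\beta$ of $n$, $c(\alpha,\beta)=\sum_{i\in D(\alpha)\cap D(\beta)}i$ and $n(\alpha)=\sum_{i\in D(\alpha)}i$. $\mathbf{Sym}=\mathbb{C}(q,t)\langle\mathbf{h}_1,\mathbf{h}_2,\ldots\rangle$ is the free associative algebra of non-commutative symmetric functions; $\mathbf{h}_\alpha(A)=\mathbf{h}_{\alpha_1}\cdots\mathbf{h}_{\alpha_{l(\alpha)}}$. The ribbon Schur functions $\mathbf{R}_\alpha(A)=\sum_{\beta\ge\alpha}(-1)^{l(\alpha)-l(\beta)}\mathbf{h}_\beta(A)$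 form a basis. The map $\omega^c$ is the $\mathbb{C}(q,t)$-linear involution of $\mathbf{Sym}$ with $\omega^c(\mathbf{R}_\alpha(A))=\mathbf{R}_{\alpha^c}(A)$. For compositions $\alpha\le\gamma$ of $n$, the $\gamma$-ribbon Schur function is $$\mathbf{R}_\alpha^{(\gamma)}(A;t)=\sum_{\substack{\beta\ge\alpha\\ D(\alpha)\setminus D(\beta)\subseteq D(\gamma)}}t^{c(\alpha,\beta^c)}\mathbf{R}_\beta(A),$$ and $\mathbf{R}_\alpha^{(\gamma)}(A;1/t)$ is obtained by replacing $t$ by $1/t$. *)

(* Defs.v *)
From HB Require Import structures.
From mathcomp Require Import all_boot all_order all_algebra.
From mathcomp Require Import reals complex finmap.
From mathcomp.multinomials Require Import monalg.

Set Implicit Arguments.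
Unset Strict Implicit.
Unset Printing Implicit Defensive.

Import GRing.Theory.
Local Open Scope ring_scope.

Section Compositions.
Variable n : nat.

Record composition := Composition {
  parts :> seq nat;
  compositionP : (0%N \notin parts) && (sumn parts == n) }.

HB.instance Definition _ := [isSub for parts].
HB.instance Definition _ := [Countable of composition by <:].

Implicit Types (a b : composition) (S : {set 'I_n}).

(* All descents are smaller than n, so a set over 'I_n can hold them. *)
Definition descents a : {set 'I_n} :=
  [set i : 'I_n | [exists k : 'I_(size a),
     (0 < k)%N && (i == sumn (take k a) :> nat)]].

Lemma sumn_composition a : sumn a = n.
Proof. by case/andP: (compositionP a) => _ /eqP. Qed.

Lemma composition_gt0 a x : x \in (a : seq nat) -> (0 < x)%N.
Proof.
by case: x => // a0; case/andP: (compositionP a); rewrite a0.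
Qed.

Let ssums a := scanl addn 0%N a.

Lemma nth_ssums (s : seq nat) k x :
  (k < size s)%N -> nth 0%N (scanl addn x s) k = (x + sumn (take k.+1 s))%N.
Proof.
elim: s x k => // y s IHs x [|k] /= lt_k; first by rewrite take0 /= addn0.
by rewrite IHs // addnA.
Qed.

Let ssums_path (s : seq nat) x :
  0%N \notin s -> path ltn x (scanl addn x s).
Proof.
elim: s x => // y s IHs x; rewrite inE negb_or => /andP[y0 /IHs p] /=.
by rewrite p andbT -{1}(addn0 x) ltn_add2l lt0n eq_sym.
Qed.

Let last_ssums (s : seq nat) x : last x (scanl addn x s) = (x + sumn s)%N.
Proof. by elim: s x => [|y s IHs] x /=; rewrite ?addn0 // IHs addnA. Qed.

Let mem_descents a (i : 'I_n) : (i \in descents a) = (val i \in ssums a).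
Proof.
rewrite inE; apply/existsP/idP => [[k /andP[k0 /eqP e]]|].
  rewrite -[val i]/(nat_of_ord i) e; apply/(nthP 0%N); exists k.-1.
    by rewrite size_scanl (leq_ltn_trans (leq_pred _)).
  by rewrite nth_ssums ?(leq_ltn_trans (leq_pred _)) // prednK.
case/(nthP 0%N) => k; rewrite size_scanl => lt_k; rewrite nth_ssums // add0n => e.
have lt_k1 : (k.+1 < size a)%N.
  rewrite ltn_neqAle lt_k andbT; apply/eqP => ek.
  by have:= ltn_ord i; rewrite -[nat_of_ord i]/(val i) -e ek take_size sumn_composition ltnn.
by exists (Ordinal lt_k1); rewrite /= e.
Qed.

Let enumS S := [seq val i | i <- enum S].

Let sorted_enumS S : sorted ltn (enumS S).
Proof.
apply: (@subseq_sorted _ _ ltn_trans _ (iota 0 n)); last exact: iota_ltn_sorted.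
have -> : enumS S = [seq val i | i <- filter (mem S) (enum 'I_n)] by rewrite enumT.
by rewrite -val_enum_ord map_subseq ?filter_subseq.
Qed.

Let sorted_rcons S : sorted ltn (rcons (enumS S) n).
Proof.
case E: (enumS S) (sorted_enumS S) => [|y s] //= p.
rewrite rcons_path p; suff: last y s \in enumS S by case/mapP => i _ ->; apply: ltn_ord.
by rewrite E mem_last.
Qed.

Let ssums_descents a : (0 < n)%N -> ssums a = rcons (enumS (descents a)) n.
Proof.
move=> n0; have p: path ltn 0%N (ssums a).
  by apply: ssums_path; case/andP: (compositionP a).
have l : last 0%N (ssums a) = n by rewrite last_ssums sumn_composition.
apply: (irr_sorted_eq ltn_trans ltnn (path_sorted p) (sorted_rcons _)) => x.
case: (ltngtP x n) => [lt_x|gt_x|->]; last first.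
- rewrite mem_rcons mem_head -[in LHS]l; case: (ssums a) l => [/= e|y s _] /=.
    by rewrite -e in n0.
  exact: mem_last.
- rewrite mem_rcons inE gtn_eqF //= (introF mapP) => [|[i _ e]]; last first.
    by move: gt_x; rewrite e ltnNge ltnW // ltn_ord.
  apply/negP => /(nthP 0%N) [k]; rewrite size_scanl => lt_k.
  rewrite nth_ssums // add0n => e; move: gt_x.
  by rewrite -e -(sumn_composition a) -{1}(cat_take_drop k.+1 a) sumn_cat ltnNge leq_addr.
- rewrite mem_rcons inE ltn_eqF //= -[x]/(val (Ordinal lt_x)) -mem_descents.
  by rewrite mem_map ?mem_enum //; apply: val_inj.
Qed.

Let comp_seq S : seq nat :=
  if n is 0 then [::] else pairmap (fun x y => y - x)%N 0%N (rcons (enumS S) n).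

Let comp_seqE S : (0 < n)%N ->
  comp_seq S = pairmap (fun x y => y - x)%N 0%N (rcons (enumS S) n).
Proof. by rewrite /comp_seq; move: (pairmap _ _ _) => s; case: (n). Qed.

Let scanlK_addn x (s : seq nat) :
  pairmap (fun x y => y - x)%N x (scanl addn x s) = s.
Proof. by elim: s x => //= y s IHs x; rewrite addKn IHs. Qed.

Let pairmapK_addn x (s : seq nat) : path ltn x s ->
  scanl addn x (pairmap (fun x y => y - x)%N x s) = s.
Proof.
by elim: s x => //= y s IHs x /andP[/ltnW lt_xy /IHs p]; rewrite subnKC // p.
Qed.

Let notin0_pairmap x (s : seq nat) : path ltn x s ->
  0%N \notin pairmap (fun x y => y - x)%N x s.
Proof.
elim: s x => //= y s IHs x /andP[lt_xy /IHs p].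
by rewrite inE negb_or p andbT neq_ltn subn_gt0 lt_xy.
Qed.

Let descentsK : pcancel (@descents) (fun S => insub (comp_seq S)).
Proof.
move=> a; suff -> : comp_seq (descents a) = a by rewrite valK.
rewrite /comp_seq; case E: {1}n => [|m]; last first.
  by rewrite -ssums_descents ?scanlK_addn // E.
have:= sumn_composition a; rewrite E; have:= @composition_gt0 a.
case: (parts a) => // y s /(_ y (mem_head _ _)); case: y => //.
Qed.

HB.instance Definition _ := isFinite.Build composition (pcan_enumP descentsK).

Lemma descents_inj : injective descents.
Proof. exact: pcan_inj descentsK. Qed.

Lemma descents_gt0 a i : i \in descents a -> (0 < i)%N.
Proof.
rewrite inE => /existsP[k /andP[k0 /eqP ->]].
case: a k k0 => -[|x s] ax [[|k] lt_k] //= _.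
by rewrite addn_gt0 (@composition_gt0 (Composition ax)) ?mem_head.
Qed.

Lemma descents_surj S : (forall i, i \in S -> (0 < i)%N) ->
  exists a, descents a == S.
Proof.
move=> S0; have p : (0 < n)%N -> path ltn 0%N (rcons (enumS S) n).
  move=> n0; case E: (enumS S) (sorted_rcons S) => [|y s] /=; first by rewrite n0.
  move=> ->; rewrite andbT.
  have: y \in enumS S by rewrite E mem_head.
  by case/mapP => i; rewrite mem_enum => /S0 i0 ->.
have cP : (0%N \notin comp_seq S) && (sumn (comp_seq S) == n).
  rewrite /comp_seq; case E: {1 3}n => [|m]; first by rewrite E.
  have n0 : (0 < n)%N by rewrite E.
  rewrite notin0_pairmap ?p //= -[sumn _]add0n -last_ssums.
  by rewrite pairmapK_addn ?p // last_rcons.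
exists (Composition cP); apply/eqP/setP => i; rewrite mem_descents /ssums /=.
have n0 : (0 < n)%N by apply: leq_ltn_trans (ltn_ord i).
rewrite comp_seqE // pairmapK_addn ?p // mem_rcons inE ltn_eqF //= mem_map ?mem_enum //; exact: val_inj.
Qed.

Lemma size_descents a : (0 < n)%N -> size a = #|descents a|.+1.
Proof.
move=> n0; rewrite cardE -(size_map val) -(size_rcons _ n) -ssums_descents //.
by rewrite size_scanl.
Qed.

(* [refines a b] is a <= b in the refinement order: a is the finer one. *)
Definition refines a b := descents b \subset descents a.

Lemma compl_subproof a :
  exists b, descents b == [set i : 'I_n | (0 < i)%N] :\: descents a.
Proof. by apply: descents_surj => i; rewrite !inE => /andP[]. Qed.

Definition compl a := xchoose (compl_subproof a).

Lemma descents_compl a :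
  descents (compl a) = [set i : 'I_n | (0 < i)%N] :\: descents a.
Proof. exact/eqP/(xchooseP (compl_subproof a)). Qed.

Lemma complK : involutive compl.
Proof.
move=> a; apply: descents_inj; apply/setP => i.
rewrite !descents_compl; move: (descents a) (@descents_gt0 a i) => S.
by rewrite !inE; case: (i \in S) => [->|_] //; case: (0 < i)%N.
Qed.

Definition cstat a b : nat := (\sum_(i in descents a :&: descents b) i)%N.
Definition nstat a : nat := (\sum_(i in descents a) i)%N.

Let size_sub a b : (size a - size b = #|descents a| - #|descents b|)%N.
Proof.
case: (posnP n) => [n0|n0]; last by rewrite !size_descents.
have s0 (c : composition) : size c = 0%N.
  have := sumn_composition c; have := @composition_gt0 c.
  case: (parts c) => // -[|y] s /(_ _ (mem_head _ _)) //= _.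
  by rewrite n0.
have d0 (c : composition) : #|descents c| = 0%N.
  apply/eqP; rewrite cards_eq0; apply/eqP/setP => i.
  by case: (i) => k lt_k; exfalso; rewrite n0 in lt_k.
by rewrite !s0 !d0.
Qed.

Let signr_subn (K : nzRingType) p q : (q <= p)%N ->
  (-1) ^+ (p - q) = (-1) ^+ (p + q) :> K.
Proof. by move=> qp; rewrite -signr_odd oddB // -oddD signr_odd. Qed.

Section Moebius.
Variable K : comNzRingType.

Let sum_sign (a d : composition) : \sum_(b : composition | refines a b && refines b d) (-1) ^+ #|descents b|
  = (-1) ^+ #|descents a| *+ (a == d) :> K.
Proof.
pose P S := (descents d \subset S) && (S \subset descents a).
have -> : \sum_(b : composition | refines a b && refines b d) (-1) ^+ #|descents b| =
          \sum_(S | P S) (-1) ^+ #|S| :> K.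
  rewrite -(big_imset (fun S : {set 'I_n} => (-1) ^+ #|S| : K) (in2W descents_inj)).
  apply: eq_bigl => S; rewrite /P; apply/imsetP/andP => [[b]|[dS Sa]].
    by move=> /andP[ab bd] ->.
  have [|b /eqP eS] := @descents_surj S.
    by move=> i /(subsetP Sa); apply: descents_gt0.
  by exists b; rewrite // unfold_in /refines eS Sa dS.
case: (eqVneq a d) => [ad|ad]; last first.
  rewrite mulr0n; case: (boolP (descents d \subset descents a)) => [da|dNa]; last first.
    rewrite big1 // => S /andP[dS Sa]; case/negP: dNa; exact: subset_trans Sa.
  have /subsetPn[x xa xd] : ~~ (descents a \subset descents d).
    apply: contra ad => ad; apply/eqP/descents_inj/eqP.
    by rewrite eqEsubset ad.
  rewrite (bigID (fun S : {set 'I_n} => x \in S)) /= addrC.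
  rewrite [X in _ + X](reindex_onto (fun S => x |: S) (fun S => S :\ x)) /=; last first.
    by move=> S /andP[_ xS]; rewrite setD1K.
  rewrite (eq_bigl (fun S => P S && (x \notin S))) => [|S]; last by [].
  rewrite -[X in X + _]opprK -sumrN addrC; apply/eqP; rewrite subr_eq0; apply/eqP.
  apply: eq_big => [S|S].
    case: (boolP (x \in S)) => xS.
      rewrite andbF; apply/negP => /andP[_ /eqP e].
      by have := xS; rewrite -e !inE eqxx.
    rewrite setU11 setU1K // eqxx !andbT /P subUset sub1set xa /=; congr andb.
    apply/idP/idP => [/subsetP h|h]; last exact: subset_trans (subsetUr _ _).
    apply/subsetP => y yd; have := h y yd; rewrite !inE => /orP[/eqP e|//].
    by rewrite -e yd in xd.
  case/andP => /andP[_ _] /eqP e.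
  have xS : x \notin S by rewrite -e !inE eqxx.
  by rewrite cardsU1 xS exprS mulN1r.
rewrite mulr1n (big_pred1 (descents a)) // => S; rewrite /P -ad -eqEsubset eq_sym.
by [].
Qed.

Variables (V : lmodType K) (F : composition -> V).

Lemma moebius_outer a :
  \sum_(b : composition | refines a b) (-1) ^+ (size a - size b) *:
    (\sum_(d : composition | refines b d) F d) = F a.
Proof.
transitivity (\sum_(d : composition) (\sum_(b : composition | refines a b && refines b d)
    (-1) ^+ #|descents b|) *: ((-1) ^+ #|descents a| *: F d)).
  under [RHS]eq_bigr do rewrite scaler_suml.
  rewrite (exchange_big_dep (refines a)) /=; last by move=> d b _ /andP[].
  apply: eq_bigr => b ab; rewrite scaler_sumr.
  apply: eq_big => [d|d _]; first by rewrite ab.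
  rewrite scalerA size_sub signr_subn ?subset_leq_card //.
  by rewrite exprD mulrC.
rewrite (bigD1 a) //= [X in _ + X]big1 => [|d /negPf da].
  by rewrite addr0 sum_sign eqxx scalerA -expr2 sqrr_sign scale1r.
by rewrite sum_sign eq_sym da scale0r.
Qed.

Lemma moebius_inner a :
  \sum_(b : composition | refines a b) \sum_(d : composition | refines b d)
    (-1) ^+ (size b - size d) *: F d = F a.
Proof.
transitivity (\sum_(d : composition) (\sum_(b : composition | refines a b && refines b d)
    (-1) ^+ #|descents b|) *: ((-1) ^+ #|descents d| *: F d)).
  under [RHS]eq_bigr do rewrite scaler_suml.
  rewrite [RHS](exchange_big_dep (refines a)) /=; last by move=> d b _ /andP[].
  apply: eq_bigr => b ab.
  apply: eq_big => [d|d bd]; first by rewrite ab.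
  by rewrite scalerA size_sub signr_subn ?subset_leq_card // exprD.
rewrite (bigD1 a) //= [X in _ + X]big1 => [|d /negPf da].
  by rewrite addr0 sum_sign eqxx scalerA -expr2 sqrr_sign scale1r.
by rewrite sum_sign eq_sym da scale0r.
Qed.

End Moebius.

End Compositions.

Section NSym_theory.
Variable K : fieldType.

(* The free associative algebra is the monoid algebra of the free monoid.
   The letter k : nat stands for h_(k+1); as usual h_0 = 1. *)
Definition NSym := {malg K[{fmonom nat}]}.

Definition hgen (i : nat) : NSym := if i is k.+1 then << fmu k >> else 1.

Definition hcomp n (a : composition n) : NSym := \prod_(i <- a) hgen i.

Definition ribbon n (a : composition n) : NSym :=
  \sum_(b : composition n | refines a b) (-1) ^+ (size a - size b) *: hcomp b.

(* The gamma-ribbon function at parameter x (meaningful when a <= gamma); it is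
   a function of x so that it can be taken both at t and at 1/t. *)
Definition gribbon n (gamma a : composition n) (x : K) : NSym :=
  \sum_(b : composition n | refines a b &&
                            (descents a :\: descents b \subset descents gamma))
    x ^+ cstat a (compl b) *: ribbon b.

Lemma hcomp_ribbon n (a : composition n) :
  hcomp a = \sum_(b : composition n | refines a b) ribbon b.
Proof. by rewrite -[LHS](moebius_inner (@hcomp n)). Qed.

Let hcompE n (a : composition n) : hcomp a = << FMonom (map predn a) >>.
Proof.
rewrite /hcomp; have := @composition_gt0 n a.
elim: (parts a) => [|[|k] s IHs] gt0; first by rewrite big_nil -fmoneE.
  by have := gt0 _ (mem_head _ _).
rewrite big_cons IHs => [|x xs]; last by rewrite gt0 // inE xs orbT.
by rewrite malgM_def fgmulUU mulr1 /= fmuE -[mmul _ _]/(fmmul _ _) fmmulE.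
Qed.

Let wordP (w : {fmonom nat}) :
  (0%N \notin map succn w) && (sumn (map succn w) == sumn (map succn w)).
Proof. by rewrite eqxx andbT; apply/negP => /mapP[]. Qed.

Let word_comp w := Composition (wordP w).

Let lext (V : lmodType K) (f : {fmonom nat} -> V) (g : NSym) : V :=
  \sum_(w <- msupp g) g@_w *: f w.

Let lextEw (V : lmodType K) (f : {fmonom nat} -> V) (d : {fset {fmonom nat}}) g :
  (msupp g `<=` d)%fset -> lext f g = \sum_(w <- d) g@_w *: f w.
Proof.
move=> le; rewrite [LHS](big_fset_incl _ le) => //= x xd /mcoeff_outdom ->.
by rewrite scale0r.
Qed.

Let lext_linear (V : lmodType K) (f : {fmonom nat} -> V) : linear (lext f).
Proof.
move=> c g1 g2; pose d := (msupp g1 `|` msupp g2 `|` msupp (c *: g1 + g2))%fset.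
have [d1 d2] : (msupp g1 `<=` d)%fset /\ (msupp g2 `<=` d)%fset.
  by split; apply: fsubset_trans (fsubsetUl _ _); rewrite (fsubsetUl, fsubsetUr).
rewrite (lextEw _ d1) (lextEw _ d2) (@lextEw _ _ d) ?fsubsetUr //.
rewrite scaler_sumr -big_split /=; apply: eq_bigr => w _.
by rewrite mcoeffD mcoeffZ scalerDl scalerA.
Qed.

Let lextU (V : lmodType K) (f : {fmonom nat} -> V) w : lext f << w >> = f w.
Proof. by rewrite (lextEw _ msuppU_le) big_seq_fset1 mcoeffUU scale1r. Qed.

Let omega_fun n (a : composition n) : NSym :=
  \sum_(b : composition n | refines a b) ribbon (compl b).

Let omega_fun_eq n m (a : composition n) (b : composition m) :
  a = b :> seq nat -> omega_fun a = omega_fun b.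
Proof.
move=> e; have nm : n = m by rewrite -(sumn_composition a) e sumn_composition.
by case: m / nm b e => b /val_inj ->.
Qed.

Let omega_def := lext (fun w => omega_fun (word_comp w)).

Let omega_hcomp n (a : composition n) : omega_def (hcomp a) = omega_fun a.
Proof.
rewrite hcompE /omega_def lextU; apply: omega_fun_eq => /=.
rewrite -map_comp -[RHS]map_id; apply/eq_in_map => x /(@composition_gt0 n a) x0 /=.
by rewrite prednK.
Qed.

(* The ribbons span NSym, so omegac is determined by its values on them. *)
Lemma linear_ribbon_ext (V : lmodType K) (f g : {linear NSym -> V}) :
  (forall n (a : composition n), f (ribbon a) = g (ribbon a)) -> f =1 g.
Proof.
move=> fg x; rewrite [x]monalgE !linear_sum /=; apply: eq_bigr => w _.
have -> : << x@_w *g w >> = x@_w *: hcomp (word_comp w).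
  rewrite hcompE /= -map_comp map_id_in; last by [].
  apply/malgP => k; rewrite mcoeffZ !mcoeffU fmK.
  by case: (w == k); rewrite ?mulr1 ?mulr0.
by rewrite !linearZ hcomp_ribbon !linear_sum /=; congr (_ *: _); apply: eq_bigr.
Qed.

(* The linear involution exchanging ribbons of complementary compositions,
   together with a proof that there is one; unique by linear_ribbon_ext. *)
Theorem omegac_ex : {f : {linear NSym -> NSym} |
  involutive f /\ forall n (a : composition n), f (ribbon a) = ribbon (compl a)}.
Proof.
pose fL := GRing.isLinear.Build K NSym NSym *:%R omega_def (lext_linear _).
pose f : {linear NSym -> NSym} := HB.pack omega_def fL.
have fR n (a : composition n) : f (ribbon a) = ribbon (compl a).
  rewrite linear_sum -[RHS](moebius_outer (fun b => ribbon (compl b))).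
  by apply: eq_bigr => b _; rewrite linearZ -[f _]/(omega_def _) omega_hcomp.
exists f; split=> // x.
have := @linear_ribbon_ext _ (f \o f) idfun _ x; apply=> n a.
by rewrite -[LHS]/(f (f (ribbon a))) !fR complK.
Qed.

Definition omegac : {linear NSym -> NSym} := sval omegac_ex.

Lemma omegacK : involutive omegac.
Proof. exact: (svalP omegac_ex).1. Qed.

Lemma omegac_ribbon n (a : composition n) : omegac (ribbon a) = ribbon (compl a).
Proof. exact: (svalP omegac_ex).2. Qed.

End NSym_theory.

(* C(q,t) as the field of fractions of C[q][t]: the inner variable is q, the outer t. *)
Definition Cqt (R : realType) : fieldType := {fraction {poly {poly R[i]}}}.
Definition tvar (R : realType) : Cqt R := tofrac ('X : {poly {poly R[i]}}).

(* Main.v *)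
(** Applying [omegac] turns the sum over [beta] into a sum over its complement.
    Since [D(alpha)] contains [D(gamma)], both sides range over the [beta] with
    [D(alpha) \ D(gamma) <= D(beta) <= D(alpha)].  For those, the exponent of
    [t] on the left sums [D(gamma) \ D(beta)] and that of [1/t] on the right sums
    [D(gamma) /\ D(beta)], so together they account for [n(gamma)]. *)

Require Import Defs.
From mathcomp Require Import all_boot all_order all_algebra.
From mathcomp Require Import reals complex finmap.
From mathcomp.multinomials Require Import monalg.

Set Implicit Arguments.
Unset Strict Implicit.
Unset Printing Implicit Defensive.

Local Open Scope ring_scope.

Import GRing.Theory.

Section ComplementaryIntervals.
Variables (n : nat) (gamma alpha zeta : composition n).
Hypothesis le_alpha_gamma : refines alpha gamma.
Hypothesis descents_zeta : descents zeta =
  (descents (compl gamma) :\: descents alpha) :|: descents gamma.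

(** The two conditions trade places: off [D(gamma)], [D(zeta)] is the complement of [D(alpha)], so
    refinement on either side is the difference condition on the other. *)
Lemma gribbon_range_compl (b : composition n) :
  refines zeta (compl b) &&
    (descents zeta :\: descents (compl b) \subset descents gamma) =
  refines alpha b && (descents alpha :\: descents b \subset descents gamma).
Proof.
(* ['I_n] contains 0, which is never a descent; positivity is recorded before the sets become
   variables. *)
move: le_alpha_gamma (@descents_gt0 n alpha) (@descents_gt0 n b).
rewrite /refines descents_zeta !descents_compl.
move: (descents alpha) (descents b) (descents gamma) => A B G.
move=> /subsetP GA A0 B0.
apply/andP/andP => -[/subsetP sub /subsetP diff]; split; apply/subsetP => i;
  move: (sub i) (diff i) (GA i) (A0 i) (B0 i); rewrite !inE;
  case: (i \in A); case: (i \in B); case: (i \in G); case: (0 < i)%N => //=;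
  by intuition.
Qed.

(** Here [D(alpha) \ D(b)] equals [D(gamma) \ D(b)], and [D(b)] meets [D(zeta)] only inside
    [D(gamma)]. *)
Lemma cstat_compl_add (b : composition n) :
  refines alpha b ->
  descents alpha :\: descents b \subset descents gamma ->
  (cstat alpha (compl b) + cstat zeta b)%N = nstat gamma.
Proof.
rewrite /cstat /nstat descents_zeta !descents_compl.
move: le_alpha_gamma (@descents_gt0 n alpha); rewrite /refines.
move: (descents alpha) (descents b) (descents gamma) => A B G.
move=> /subsetP GA A0 /subsetP sub /subsetP diff.
rewrite [RHS](big_setID B) addnC /=; congr (_ + _)%N;
  apply: eq_bigl => i; apply/idP/idP; move: (sub i) (diff i) (GA i) (A0 i); rewrite !inE;
  case: (i \in A); case: (i \in B); case: (i \in G); case: (0 < i)%N => //=;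
  by intuition.
Qed.

Lemma omegac_gribbon (K : fieldType) (x : K) : x != 0 ->
  omegac K (gribbon gamma alpha x) =
  x ^+ nstat gamma *: gribbon gamma zeta x^-1.
Proof.
move=> x0; rewrite linear_sum scaler_sumr /=.
rewrite [RHS](reindex_inj (inv_inj (@complK n))) /=.
apply: eq_big => [b|b /andP[sub diff]]; first by rewrite gribbon_range_compl.
rewrite linearZ /= omegac_ribbon scalerA complK.
(* The [zeta] part of [x ^+ nstat gamma] cancels the power of [x^-1], as [x] is nonzero. *)
by rewrite -(cstat_compl_add sub diff) exprD exprVn mulfK ?expf_neq0.
Qed.

End ComplementaryIntervals.

Theorem proposition15 (R : realType) (n : nat)
  (gamma alpha zeta : composition n) :
  refines alpha gamma ->
  descents zeta = (descents (compl gamma) :\: descents alpha) :|: descents gamma ->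
  @omegac (Cqt R) (gribbon gamma alpha (tvar R)) =
  tvar R ^+ nstat gamma *: gribbon gamma zeta (1 / tvar R).
Proof.
move=> le_ag dz; rewrite div1r; apply: omegac_gribbon => //.
by rewrite /tvar tofrac_eq0 polyX_eq0.
Qed.
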